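(* Let $\mathrm{PoF}_n$ denote the price of PROP1 with respect to utilitarian welfare for allocating contiguous blocks of goods to $n$ agents. Then $\mathrm{PoF}_n=\Omega(\sqrt n)$ and $\mathrm{PoF}_n=O(n)$; that is, there are absolute constants $c,C>0$ such that $c\sqrt n\le \mathrm{PoF}_n\le C n$ for every integer $n\ge 3$.
   Context: A fair-goods instance $\mathcal I=\langle N,E,\mathcal V\rangle$ consists of agents $N=\{1,\dots,n\}$, indivisible items $E=\{e_1,\dots,e_m\}$ placed on a path in this order, and for each agent $i$ an additive valuation $v_i$ (i.e. $v_i(S)=\sum_{e\in S}v_i(e)$) with $v_i(e)\ge 0$ for all $e\in E$, normalized so that $v_i(\emptyset)=0$, $v_i(E)=1$. A bundle is connected if it is a set of consecutive items (the empty set is allowed). An allocation $\mathbf A=(A_1,\dots,A_n)$ is a partition of $E$ into $n$ pairwise disjoint connected (possibly empty) bundles, $A_i$ being given to agent $i$ (the left-to-right order of the agents' bundles is arbitrary). Its utilitarian welfare is $\mathsf{UW}(\mathbf A)=\sum_{i\in N}v_i(A_i)$; $\mathsf{OPT}_U(\mathcal I)$ is the maximum of $\mathsf{UW}$ over all allocations of $\mathcal I$. An allocation $\mathbf A$ is PROP1 (proportional up to one item) if for every $i\in N$, either $v_i(A_i)\ge\frac1n v_i(E)$, or there is an item $e\in E\setminus A_i$ such that $A_i\cup\{e\}$ is connected and $v_i(A_i\cup\{e\})\ge\frac1n v_i(E)$. The price of fairness is $\mathrm{PoF}_n=\sup_{\mathcal I}\min_{\mathbf A}\frac{\mathsf{OPT}_U(\mathcal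 I)}{\mathsf{UW}(\mathbf A)}$, the supremum over all fair-goods instances with $n$ agents (any number of items) and the minimum over all PROP1 allocations $\mathbf A$ of $\mathcal I$; conventions: $c/0=+\infty$ for $c>0$ and $0/0=1$. *)

(* Defs.v *)
From HB Require Import structures.
From mathcomp Require Import all_boot all_order all_algebra.
From mathcomp Require Import boolp classical_sets reals constructive_ereal ereal.
Set Implicit Arguments.
Unset Strict Implicit.
Unset Printing Implicit Defensive.
Import Order.TTheory GRing.Theory Num.Theory.
Local Open Scope ring_scope.

Record goods_instance (R : realType) (n : nat) := Instance {
  nitems : nat;
  item_value : 'I_n -> 'I_nitems -> R;
  item_value_ge0 : forall i e, 0 <= item_value i e;
  item_value_sum1 : forall i, \sum_(e < nitems) item_value i e = 1
}.

Definition bundle_value (R : realType) (n : nat) (I : goods_instance R n) (i : 'I_n)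
    (S : {set 'I_(nitems I)}) : R :=
  \sum_(e in S) item_value i e.

(* The bounds range over the m + 1 gaps of the path of m items; a = b gives
   the empty bundle. *)
Definition connected_bundle (m : nat) (S : {set 'I_m}) : bool :=
  [exists a : 'I_m.+1, exists b : 'I_m.+1,
     S == finset (fun e : 'I_m => (a <= e < b)%N)].

Definition is_allocation (m n : nat) (A : {ffun 'I_n -> {set 'I_m}}) : bool :=
  [&& [forall i, connected_bundle (A i)],
      [forall i, forall j, (i != j) ==> [disjoint A i & A j]] &
      (\bigcup_i A i)%SET == [set: 'I_m]%SET].

Definition UW (R : realType) (n : nat) (I : goods_instance R n)
    (A : {ffun 'I_n -> {set 'I_(nitems I)}}) : R :=
  \sum_(i < n) bundle_value i (A i).

(* Since welfare is nonnegative, the default value 0 of the iterated maximum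
   does not affect the result. *)
Definition OPT_U (R : realType) (n : nat) (I : goods_instance R n) : R :=
  \big[Num.max/0]_(A : {ffun 'I_n -> {set 'I_(nitems I)}} | is_allocation A)
    UW A.

Definition PROP1 (R : realType) (n : nat) (I : goods_instance R n)
    (A : {ffun 'I_n -> {set 'I_(nitems I)}}) : bool :=
  [forall i : 'I_n,
    (n%:R^-1 * bundle_value i [set: 'I_(nitems I)]%SET <= bundle_value i (A i)) ||
    [exists e : 'I_(nitems I),
      [&& e \notin A i, connected_bundle (e |: A i)%SET &
          n%:R^-1 * bundle_value i [set: 'I_(nitems I)]%SET
            <= bundle_value i (e |: A i)%SET]]].

(* Only used for nonnegative c and d; c / 0 is +oo for c > 0, and 0 / 0 is 1. *)
Definition welfare_ratio (R : realType) (c d : R) : \bar R :=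
  if d == 0 then (if c == 0 then 1%E else +oo%E) else (c / d)%:E.

(* The iterated minimum over the empty family is +oo, so a finite value entails
   that a PROP1 allocation exists. *)
Definition instance_price (R : realType) (n : nat) (I : goods_instance R n) : \bar R :=
  \big[Order.min/+oo%E]_(A : {ffun 'I_n -> {set 'I_(nitems I)}}
      | is_allocation A && PROP1 A) welfare_ratio (OPT_U I) (UW A).

Definition PoF (R : realType) (n : nat) : \bar R :=
  ereal_sup (range (@instance_price R n)).

(* Main.v *)
(** Upper bound.  OPT is at most n, so a PROP1 allocation of welfare at least
    1/2 suffices.  An agent with an item of value at least 1/n is content with
    an empty bundle; let the k other agents share the path.  If k = 0, give
    everything to one agent.  Otherwise a moving knife yields an agent order and
    cuts such that every bundle, together with the item just before it, is
    worth at least 1/k to its owner.  Leaving the items just before the cuts to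
    their left owners, or moving them all to the right owners, gives two PROP1
    allocations.  Each extended bundle is covered by the two bundles of its
    owner, so the two welfares add up to at least 1.

    Lower bound.  With s close to sqrt n, take s agents valuing disjoint blocks
    of n items each, and n - s agents valuing all s * n items equally.  OPT is
    at least s, but PROP1 gives at least s - 1 items to every uniform agent,
    which leaves at most 2n items to the block agents: the welfare is at
    most 3. *)

Require Import Defs.
From HB Require Import structures.
From mathcomp Require Import all_boot all_order all_algebra.
From mathcomp Require Import boolp classical_sets reals constructive_ereal ereal.
From mathcomp Require Import zify lra.
Set Implicit Arguments.
Unset Strict Implicit.
Unset Printing Implicit Defensive.
Import Order.TTheory GRing.Theory Num.Theory.
Local Open Scope ring_scope.

(** * Allocations given by cuts of the path *)

Definition gap_interval (m a b : nat) : {set 'I_m} :=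
  finset (fun e : 'I_m => (a <= e < b)%N).

(** [s] is the left-to-right order of the agents; the agent at place [j] receives the items between
    the gaps [c j] and [c j.+1]. *)
Definition cut_allocation (m n : nat) (s : seq 'I_n) (c : nat -> nat) :
    {ffun 'I_n -> {set 'I_m}} :=
  [ffun i => gap_interval m (c (index i s)) (c (index i s).+1)].

Lemma connected_gap_interval (m a b : nat) :
  (a <= m)%N -> (b <= m)%N -> connected_bundle (gap_interval m a b).
Proof.
move=> am bm; apply/existsP; exists (inord a); apply/existsP; exists (inord b).
by apply/eqP/setP=> e; rewrite !inE !inordK.
Qed.

Lemma index_enumeration_lt (n : nat) (s : seq 'I_n) (i : 'I_n) :
  perm_eq s (enum 'I_n) -> (index i s < n)%N.
Proof.
move=> ps; rewrite -{2}(size_enum_ord n) -(perm_size ps) index_mem.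
by rewrite (perm_mem ps) mem_enum.
Qed.

Lemma cut_allocationP (m n : nat) (s : seq 'I_n) (c : nat -> nat) :
  perm_eq s (enum 'I_n) -> {homo c : j k / (j <= k)%N} -> c 0%N = 0%N ->
  c n = m -> is_allocation (cut_allocation m s c).
Proof.
move=> ps cm c0 cn; have idx i := index_enumeration_lt i ps.
have mem_s i : i \in s by rewrite (perm_mem ps) mem_enum.
apply/and3P; split.
- apply/forallP=> i; rewrite ffunE -cn.
  by apply: connected_gap_interval; apply: cm; rewrite ?idx // ltnW ?idx.
- apply/forallP=> i; apply/forallP=> j; apply/implyP=> ij.
  have {ij} : index i s != index j s.
    by apply: contraNN ij => /eqP /(congr1 (nth i s)); rewrite !nth_index // => ->.
  rewrite -setI_eq0 !ffunE => ij; apply/eqP/setP=> e; rewrite !inE.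
  by case: (ltngtP (index i s) (index j s)) ij => // /cm; lia.
- apply/eqP/setP=> e; rewrite inE; apply/bigcupP.
  (* The owner of [e] stands just before the first cut lying beyond [e]. *)
  have ex : exists j, (e < c j)%N by exists n; rewrite cn.
  have := ex_minnP ex; case=> -[|j]; first by rewrite c0.
  move=> ecj minj.
  have cje : (c j <= e)%N by rewrite leqNgt; apply/negP=> /minj; rewrite ltnn.
  have jn : (j < n)%N by apply: minj; rewrite cn.
  have js : (j < size s)%N by rewrite (perm_size ps) size_enum_ord.
  exists (nth (Ordinal jn) s j) => //; rewrite ffunE inE index_uniq ?cje //.
  by rewrite (perm_uniq ps) enum_uniq.
Qed.

(** * Interval values and PROP1 criteria for a single agent *)

Section Bundles.
Variables (R : realType) (n : nat) (I : goods_instance R n).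
Let m := nitems I.

(** Interval values become differences of this monotone function, so later estimates are linear
    arithmetic. *)
Definition prefix_value (i : 'I_n) (a : nat) : R :=
  bundle_value i (gap_interval m 0 a).

Lemma bundle_value_gap_interval (i : 'I_n) (a b : nat) : (a <= b)%N ->
  bundle_value i (gap_interval m a b) = prefix_value i b - prefix_value i a.
Proof.
move=> ab; apply/eqP; rewrite eq_sym subr_eq addrC; apply/eqP.
rewrite /prefix_value /bundle_value (bigID (fun e : 'I_m => e < a)%N) /=.
by congr (_ + _); apply: eq_bigl => e; rewrite !inE; lia.
Qed.

Lemma bundle_value_subset (i : 'I_n) (A B : {set 'I_m}) :
  A \subset B -> bundle_value i A <= bundle_value i B.
Proof.
move=> /fintype.subsetP AB; rewrite /bundle_value [leRHS](big_setID A) /=.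
rewrite (finset.setIidPr _) ?lerDl; last exact/fintype.subsetP.
by apply: sumr_ge0 => e _; apply: item_value_ge0.
Qed.

Lemma bundle_value_setT (i : 'I_n) : bundle_value i [set: 'I_m] = 1.
Proof.
rewrite /bundle_value -(item_value_sum1 I i).
by apply: eq_bigl => e; rewrite inE.
Qed.

Lemma bundle_value_ge0 (i : 'I_n) (A : {set 'I_m}) : 0 <= bundle_value i A.
Proof. by apply: sumr_ge0 => e _; apply: item_value_ge0. Qed.

Lemma bundle_value_le1 (i : 'I_n) (A : {set 'I_m}) : bundle_value i A <= 1.
Proof. by rewrite -(bundle_value_setT i) bundle_value_subset // finset.subsetT. Qed.

Lemma prefix_value_mono (i : 'I_n) :
  {homo prefix_value i : a b / (a <= b)%N >-> a <= b}.
Proof.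
move=> a b ab; apply: bundle_value_subset; apply/fintype.subsetP=> e.
by rewrite !inE; lia.
Qed.

Lemma prefix_value0 (i : 'I_n) : prefix_value i 0 = 0.
Proof. by rewrite /prefix_value /bundle_value big1 // => e; rewrite inE. Qed.

Lemma prefix_value_nitems (i : 'I_n) : prefix_value i m = 1.
Proof.
rewrite /prefix_value -(bundle_value_setT i); congr bundle_value.
by apply/setP => e; rewrite !inE ltn_ord.
Qed.

Lemma prefix_valueS (i : 'I_n) (e : 'I_m) :
  prefix_value i e.+1 - prefix_value i e = item_value i e.
Proof.
rewrite -bundle_value_gap_interval // /bundle_value (big_pred1 e) // => x.
by rewrite /= inE -val_eqE /=; lia.
Qed.

Lemma UW_le_agents (A : {ffun 'I_n -> {set 'I_m}}) : UW A <= n%:R.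
Proof.
rewrite -[n in n%:R]card_ord -sumr_const; apply: ler_sum => i _.
exact: bundle_value_le1.
Qed.

Lemma OPT_U_le_agents : OPT_U I <= n%:R.
Proof. by apply: bigmax_le => // A _; apply: UW_le_agents. Qed.

Lemma UW_le_OPT_U (A : {ffun 'I_n -> {set 'I_m}}) :
  is_allocation A -> UW A <= OPT_U I.
Proof. by move=> aA; rewrite /OPT_U (le_bigmax_cond _ _ aA). Qed.

Definition PROP1_agent (i : 'I_n) (S : {set 'I_m}) : bool :=
  (n%:R^-1 <= bundle_value i S) ||
  [exists e, [&& e \notin S, connected_bundle (e |: S)%SET &
                 n%:R^-1 <= bundle_value i (e |: S)%SET]].

Lemma PROP1E (A : {ffun 'I_n -> {set 'I_m}}) :
  PROP1 A = [forall i, PROP1_agent i (A i)].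
Proof. by apply: eq_forallb => i; rewrite bundle_value_setT mulr1. Qed.

(** The borrowed item is the one just before the bundle. For [a = 0] there is none, but then
    [a.-1 = a] and the bundle itself suffices. *)
Lemma PROP1_agent_left (i : 'I_n) (a b : nat) : (a <= b)%N -> (b <= m)%N ->
  n%:R^-1 <= prefix_value i b - prefix_value i a.-1 ->
  PROP1_agent i (gap_interval m a b).
Proof.
case: a => [|a] ab bm H.
  by rewrite /PROP1_agent bundle_value_gap_interval // H.
have am : (a < m)%N by lia.
apply/orP; right; apply/existsP; exists (Ordinal am).
have -> : (Ordinal am |: gap_interval m a.+1 b)%SET = gap_interval m a b.
  by apply/setP=> x; rewrite !inE -val_eqE /=; lia.
rewrite inE /= ltnn connected_gap_interval ?bundle_value_gap_interval //; lia.
Qed.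

Lemma PROP1_agent_right (i : 'I_n) (a b : nat) : (a <= b)%N -> (b < m)%N ->
  n%:R^-1 <= prefix_value i b.+1 - prefix_value i a ->
  PROP1_agent i (gap_interval m a b).
Proof.
move=> ab bm H; apply/orP; right; apply/existsP; exists (Ordinal bm).
have -> : (Ordinal bm |: gap_interval m a b)%SET = gap_interval m a b.+1.
  by apply/setP=> x; rewrite !inE -val_eqE /=; lia.
rewrite inE /= ltnn andbF connected_gap_interval //; last lia.
by rewrite bundle_value_gap_interval //; lia.
Qed.

(** A singleton is connected, so an empty bundle may borrow any item, wherever [a] lies. *)
Lemma PROP1_agent_empty (i : 'I_n) (a : nat) (e : 'I_m) :
  n%:R^-1 <= item_value i e -> PROP1_agent i (gap_interval m a a).
Proof.
move=> H; apply/orP; right; apply/existsP; exists e.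
have -> : (e |: gap_interval m a a)%SET = gap_interval m e e.+1.
  by apply/setP=> x; rewrite !inE -val_eqE /=; lia.
rewrite inE connected_gap_interval ?(ltnW (ltn_ord e)) //.
by rewrite bundle_value_gap_interval // prefix_valueS H andbT; lia.
Qed.

End Bundles.

(** * Upper bound: moving knife and two complementary allocations *)

(* Moving knife: the next cut [q] is the first position at which some remaining
   agent collects [t], counting also the last item before the current position
   [p].  No remaining agent has collected [t] at [q.-1], so enough value is left
   from the last item before [q] onwards. *)
Lemma moving_knife (R : realDomainType) (T : eqType) (F : T -> nat -> R)
    (t : R) (m : nat) (s : seq T) (p : nat) :
  0 < t -> (p <= m)%N ->
  {in s, forall i, {homo F i : a b / (a <= b)%N >-> a <= b}} ->
  {in s, forall i a, (a < m)%N -> F i a.+1 - F i a < t} ->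
  {in s, forall i, (size s)%:R * t <= F i m - F i p.-1} ->
  exists (s' : seq T) (c : nat -> nat),
    [/\ perm_eq s' s, c 0%N = p,
        forall j, (j <= size s)%N -> (c j <= m)%N,
        forall j, (j < size s)%N -> (c j < c j.+1)%N &
        forall j x0, (j < size s)%N ->
          t <= F (nth x0 s' j) (c j.+1) - F (nth x0 s' j) (c j).-1].
Proof.
move=> t0; elim: {s}(size s) {-2}s (erefl (size s)) p => [|k IH] s sz p pm hF small big.
  by move/size0nil: sz big => -> _; exists [::], (fun=> p).
pose P q := has (fun i => t <= F i q - F i p.-1) s.
have [i0 i0s] : exists i, i \in s.
  by case: s sz {hF small big P} => // i s _; exists i; rewrite mem_head.
have exP : exists q, P q.
  exists m; apply/hasP; exists i0 => //; apply: le_trans (big _ i0s).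
  by rewrite ler_peMl ?(ltW t0) // sz ler1n.
have := ex_minnP exP; case=> q /hasP[i si ti] minq.
have qm : (q <= m)%N.
  apply: minq; apply/hasP; exists i0 => //; apply: le_trans (big _ i0s).
  by rewrite ler_peMl ?(ltW t0) // sz ler1n.
(* The item before [p] alone is worth less than [t] (and nothing is counted twice when [p = 0]), so
   the knife must move strictly. *)
have pq : (p < q)%N.
  rewrite ltnNge; apply/negP => /(hF _ si) qp.
  suff : F i p - F i p.-1 < t by lra.
  by case: (p) pm => [|p'] pm /=; [rewrite subrr | apply: small].
have szr : size (rem i s) = k by rewrite size_rem // sz.
have sub := mem_rem (s := s) (x := i).
have [||x xs|s' [c [ps c0 cm cS ct]]] := IH _ szr q qm.
- by move=> x /sub; apply: hF.
- by move=> x /sub; apply: small.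
- have xs' := sub _ xs; have := big _ xs'; rewrite sz -natr1 mulrDl mul1r.
  have : F x q.-1 - F x p.-1 < t.
    rewrite ltNge; apply/negP=> H; have : (q <= q.-1)%N.
      by apply: minq; apply/hasP; exists x.
    lia.
  rewrite szr; lra.
exists (i :: s'), (fun j => if j is j'.+1 then c j' else p); rewrite sz.
split=> //.
- by rewrite perm_sym (perm_trans (perm_to_rem si)) // perm_cons perm_sym.
- by case=> // j jk; apply: cm; rewrite szr.
- by case=> [|j] jk; [rewrite c0 | apply: cS; rewrite szr].
- by case=> [|j] x0 jk /=; [rewrite c0 | apply: ct; rewrite szr].
Qed.

Lemma exists_PROP1_half_welfare (R : realType) (n : nat) (I : goods_instance R n) :
  (0 < n)%N ->
  exists A : {ffun 'I_n -> {set 'I_(nitems I)}},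
    [/\ is_allocation A, PROP1 A & 2%:R^-1 <= UW A].
Proof.
move=> n0; set m := nitems I.
have n0R : (0 : R) < n%:R by rewrite ltr0n.
pose small i := [forall e, item_value (g := I) i e < n%:R^-1].
pose S := [seq i <- enum 'I_n | small i].
pose L := [seq i <- enum 'I_n | ~~ small i].
pose k := size S.
have PROP1_large i a : ~~ small i -> PROP1_agent i (gap_interval m a a).
  by rewrite negb_forall => /existsP[e]; rewrite -leNgt; apply: PROP1_agent_empty.
have le_homo (c : nat -> nat) :
    (forall j, (c j <= c j.+1)%N) -> {homo c : j l / (j <= l)%N}.
  by apply: homo_leq => //; apply: leq_trans.
have [k0|k0] := posnP k.
  have large i : ~~ small i.
    apply/negP => si; have : i \in S by rewrite mem_filter si mem_enum.
    by rewrite (size0nil k0).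
  (* The first agent takes the whole path; the others get empty bundles at its right end. *)
  pose c j := if j == 0%N then 0%N else m.
  exists (cut_allocation m (enum 'I_n) c); split.
  - apply: cut_allocationP => //; last by rewrite /c eqn0Ngt n0.
    by apply: le_homo => -[|j].
  - rewrite PROP1E; apply/forallP => i; rewrite ffunE {2}/c /=.
    rewrite /c; case: eqP => _; last exact: PROP1_large.
    apply: PROP1_agent_left => //=; rewrite prefix_value_nitems prefix_value0.
    by rewrite subr0 invf_le1 // ler1n.
  - apply: le_trans (_ : 1 <= _); first by rewrite invf_le1 ?ler1n // ltr0n.
    rewrite /UW (bigD1 (Ordinal n0)) //= ffunE index_enum_ord /= {1}/c /=.
    rewrite bundle_value_gap_interval // prefix_value_nitems prefix_value0 subr0.
    by rewrite lerDl sumr_ge0 // => i _; apply: bundle_value_ge0.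
have k0R : (0 : R) < k%:R by rewrite ltr0n.
have kcard : k = #|[pred i | small i]|.
  by rewrite cardE /k /S enumT /enum_mem; congr size; apply: eq_filter.
have kn : (k <= n)%N by rewrite kcard -[leqRHS]card_ord max_card.
(* The knife runs with the threshold [1/k]: it exceeds every item value of a small agent and still
   ensures the share [1/n]. *)
have nk : (n%:R^-1 : R) <= k%:R^-1 by rewrite lef_pV2 ?posrE // ler_nat.
have [||||i iS|s' [c [ps' c0 cm cS ct]]] :=
    @moving_knife R 'I_n (@prefix_value R n I) k%:R^-1 m S 0.
- by rewrite invr_gt0.
- by [].
- by move=> i _; apply: prefix_value_mono.
- move=> i; rewrite mem_filter => /andP[/forallP si _] a am.
  by rewrite (prefix_valueS i (Ordinal am)); apply: lt_le_trans nk.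
- by rewrite prefix_value_nitems prefix_value0 subr0 divff ?gt_eqF.
have ps : perm_eq (s' ++ L) (enum 'I_n).
  by rewrite (perm_trans _ (permEl (perm_filterC small _))) // perm_cat2r.
have sz' : size s' = k by rewrite (perm_size ps').
have index_small i : small i ->
    (index i (s' ++ L) < k)%N /\ nth i s' (index i (s' ++ L)) = i.
  move=> si; have is' : i \in s' by rewrite (perm_mem ps') mem_filter si mem_enum.
  by rewrite index_cat is' -sz' index_mem nth_index.
have index_large i : ~~ small i -> (k <= index i (s' ++ L))%N.
  move=> si; rewrite index_cat (perm_mem ps') mem_filter (negbTE si) /= sz'.
  exact: leq_addr.
(* In [b] the item just before each inner cut passes to the right owner. From place [k] on both cuts
   are [m]: the last small agent takes the rest and the agents in [L] get nothing. *)
pose a j := if (j < k)%N then c j else m.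
pose b j := if (j < k)%N then (c j).-1 else m.
have am : {homo a : j l / (j <= l)%N}.
  apply: le_homo => j; rewrite /a; case: ifP => jk; case: ifP => jk' //; last lia.
  - exact/ltnW/cS.
  - exact/cm/ltnW.
have bm : {homo b : j l / (j <= l)%N}.
  apply: le_homo => j; rewrite /b; case: ifP => jk; case: ifP => jk' //; last lia.
  - by have := cS j jk; lia.
  - by have := cm j (ltnW jk); lia.
have aA : is_allocation (cut_allocation m (s' ++ L) a).
  by apply: cut_allocationP; rewrite /a ?k0 // ltnNge kn.
have bA : is_allocation (cut_allocation m (s' ++ L) b).
  by apply: cut_allocationP; rewrite /b ?k0 ?c0 // ltnNge kn.
have aP : PROP1 (cut_allocation m (s' ++ L) a).
  rewrite PROP1E; apply/forallP => i; rewrite ffunE.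
  have [si|si] := boolP (small i); last first.
    have kj := index_large _ si.
    by rewrite /a !ltnNge kj (leqW kj); apply: PROP1_large.
  have [jk ji] := index_small _ si; move: (ct _ i jk); rewrite ji.
  set j := index _ _ in jk ji *; move=> H.
  apply: PROP1_agent_left; first exact: am.
    by rewrite /a; case: ifP => // _; apply: cm.
  have : (c j.+1 <= a j.+1)%N by rewrite /a; case: ifP => // _; apply: cm.
  move=> /(prefix_value_mono I i); rewrite [a j]/a jk; lra.
have bP : PROP1 (cut_allocation m (s' ++ L) b).
  rewrite PROP1E; apply/forallP => i; rewrite ffunE.
  have [si|si] := boolP (small i); last first.
    have kj := index_large _ si.
    by rewrite /b !ltnNge kj (leqW kj); apply: PROP1_large.
  have [jk ji] := index_small _ si; move: (ct _ i jk); rewrite ji.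
  set j := index _ _ in jk ji *; move=> H.
  have := bm j j.+1 (leqnSn j); have cjm := cm _ jk; have cSj := cS _ jk.
  rewrite /b jk; case: ifP => _ bj.
    (* The borrowed item is the one before the cut [c j.+1], which [b] gave to the right
       neighbour. *)
    apply: PROP1_agent_right => //; first by lia.
    by rewrite prednK; [exact: le_trans H | lia].
  (* The last small agent keeps everything up to [m] and has no right neighbour. *)
  apply: PROP1_agent_left => //.
  have := prefix_value_mono I i cjm.
  have := prefix_value_mono I i (leq_pred (c j).-1); lra.
have UWab : 1 <= UW (cut_allocation m (s' ++ L) a)
              + UW (cut_allocation m (s' ++ L) b).
  rewrite /UW -big_split /=.
  have -> : 1 = \sum_(i < n) if small i then k%:R^-1 else 0 :> R.
    by rewrite -big_mkcond /= sumr_const -kcard -[RHS]mulr_natl divff ?gt_eqF.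
  apply: ler_sum => i _; case: ifP => si; last by rewrite addr_ge0 ?bundle_value_ge0.
  have [jk ji] := index_small _ si; move: (ct _ i jk); rewrite ji !ffunE.
  set j := index _ _ in jk ji *; move=> H.
  rewrite !bundle_value_gap_interval ?am ?bm //.
  have cjm := cm _ jk; have cSj := cS _ jk.
  have cab : (c j.+1 <= a j.+1)%N && ((c j.+1).-1 <= b j.+1)%N.
    by rewrite /a /b; case: ifP => _; lia.
  (* As cuts increase strictly, the bundles under [a] and [b] leave no gap in the extended bundle,
     so their values add up to at least [1/k]. *)
  have cc : (c j <= (c j.+1).-1)%N by lia.
  case/andP: cab.
  move=> /(prefix_value_mono I i) + /(prefix_value_mono I i).
  move: (prefix_value_mono I i cc).
  rewrite [a j]/a [b j]/b jk; lra.
have [Ha|Ha] := leP 2%:R^-1 (UW (cut_allocation m (s' ++ L) a)).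
  by exists (cut_allocation m (s' ++ L) a).
exists (cut_allocation m (s' ++ L) b); split=> //; lra.
Qed.

Lemma instance_price_le (R : realType) (n : nat) (I : goods_instance R n) :
  (0 < n)%N -> (instance_price I <= (2%:R * n%:R)%:E)%E.
Proof.
move=> n0; have [A [aA pA hA]] := exists_PROP1_half_welfare I n0.
(* Positive welfare rules out the division conventions of [welfare_ratio]. *)
have UW0 : 0 < UW A by apply: lt_le_trans hA; rewrite invr_gt0 ltr0n.
rewrite /instance_price (bigD1 A) ?aA //= ge_min; apply/orP; left.
rewrite /welfare_ratio gt_eqF // lee_fin ler_pdivrMr //.
apply: le_trans (OPT_U_le_agents I) _.
rewrite mulrAC ler_peMl ?ler0n //; lra.
Qed.

(** * Lower bound: block agents against uniform agents *)

Section HardInstance.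
Variables (R : realType) (n s : nat).
Hypotheses (n_gt0 : (0 < n)%N) (s_gt0 : (0 < s)%N).

(* [s * n] items in [s] blocks of length [n]: agent [i < s] values exactly block
   [i], every other agent values all items equally. *)
Definition hard_value (i : 'I_n) (e : 'I_(s * n)) : R :=
  if (i < s)%N then (if (e %/ n == i)%N then n%:R^-1 else 0)
  else (s * n)%:R^-1.

Let n_gt0R : (0 : R) < n%:R. Proof. by rewrite ltr0n. Qed.
Let s_gt0R : (0 : R) < s%:R. Proof. by rewrite ltr0n. Qed.

Lemma hard_value_ge0 (i : 'I_n) (e : 'I_(s * n)) : 0 <= hard_value i e.
Proof. by rewrite /hard_value; do 2?case: ifP => _; rewrite ?invr_ge0 ?ler0n. Qed.

Lemma hard_value_sum1 (i : 'I_n) : \sum_(e < s * n) hard_value i e = 1.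
Proof.
rewrite /hard_value; case: (i < s)%N / boolP => si; last first.
  by rewrite sumr_const card_ord -[LHS]mulr_natl divff // pnatr_eq0 muln_eq0; lia.
rewrite -(big_mkord xpredT (fun e => if (e %/ n == i)%N then n%:R^-1 else 0)).
(* The sum is split into blocks; only block [i] contributes, with [n] items of value [1/n]. *)
rewrite big_nat_mul.
rewrite (eq_bigr (fun b => if b == i :> nat then 1 else 0)).
  by rewrite -big_mkcond big_nat1_eq si.
move=> b _; rewrite (eq_big_nat _ _ (F2 := fun=> if b == i :> nat then n%:R^-1 else 0)).
  rewrite sumr_const_nat mulSn addnK; case: eqP => _; last by rewrite mul0rn.
  by rewrite -[LHS]mulr_natl divff ?gt_eqF.
move=> j /andP[bj jb]; congr (if _ == _ then _ else _).
by apply/eqP; rewrite eqn_leq leq_divRL // -ltnS ltn_divLR // jb bj.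
Qed.

Definition hard_instance : goods_instance R n :=
  Instance hard_value_ge0 hard_value_sum1.

Lemma hard_instance_OPT_U : (s <= n)%N -> s%:R <= OPT_U hard_instance.
Proof.
(* Agent [j < s] receives block [j]; all later agents receive empty bundles at the end. *)
move=> sn; pose c j := (minn j s * n)%N.
pose A : {ffun 'I_n -> {set 'I_(nitems hard_instance)}} :=
  cut_allocation (s * n) (enum 'I_n) c.
have aA : is_allocation A.
  apply: cut_allocationP; rewrite // /c ?min0n ?(minn_idPr sn) //.
  by move=> j l jl; rewrite leq_mul2r; lia.
apply: le_trans (UW_le_OPT_U aA).
have -> : s%:R = \sum_(i < n) if (i < s)%N then 1 else 0 :> R.
  by rewrite -big_mkcond -(big_ord_widen n (fun=> 1)) // sumr_const card_ord.
apply: ler_sum => i _; case: ifP => si; last exact: bundle_value_ge0.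
rewrite -(hard_value_sum1 i) /bundle_value [leRHS]big_mkcond /=.
apply: ler_sum => e _; rewrite ffunE index_enum_ord inE /c.
rewrite (minn_idPl (ltnW si)) (minn_idPl si).
case: ifPn => //; apply: contraNT; rewrite -ltNge /hard_value si.
case: eqP => [<- _|]; last by rewrite ltxx.
by rewrite leq_trunc_div -ltn_divLR /=.
Qed.

Lemma hard_instance_UW (A : {ffun 'I_n -> {set 'I_(nitems hard_instance)}}) :
  (s * s <= n)%N -> is_allocation A -> PROP1 A -> UW A <= 3%:R.
Proof.
move=> ssn /and3P[_ /forallP dA /eqP cA]; rewrite PROP1E => /forallP pA.
have sn : (s <= n)%N by nia.
have val_le (i : 'I_n) (S : {set 'I_(nitems hard_instance)}) : (i < s)%N ->
    bundle_value i S <= #|S|%:R / n%:R.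
  move=> si; rewrite mulr_natl -sumr_const; apply: ler_sum => e _.
  by rewrite /= /hard_value si; case: ifP => // _; rewrite invr_ge0 ler0n.
have val_ge (i : 'I_n) (S : {set 'I_(nitems hard_instance)}) : (s <= i)%N ->
    bundle_value i S = #|S|%:R / (s%:R * n%:R).
  move=> si; rewrite mulr_natl -sumr_const; apply: eq_bigr => e _.
  by rewrite /= /hard_value ltnNge si natrM.
(* A uniform agent needs [s] items of value [1/(s * n)] to reach [1/n], and at most one of them is
   borrowed. *)
have card_ge (i : 'I_n) : (s <= i)%N -> (s <= #|A i|.+1)%N.
  move=> si; rewrite -(ler_nat R).
  have key (x : R) : n%:R^-1 <= x / (s%:R * n%:R) -> s%:R <= x.
    by rewrite ler_pdivlMr ?mulr_gt0 // mulrCA mulVf ?gt_eqF // mulr1.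
  have /orP[|/existsP[e /and3P[eA _]]] := pA i; rewrite val_ge // => /key.
    by move=> /le_trans; apply; rewrite ler_nat.
  by rewrite cardsU1 eA add1n.
have card_sum : (\sum_(i < n) #|A i| = s * n)%N.
  transitivity (\sum_(i < n) \sum_(e in A i) 1)%N.
    by apply: eq_bigr => i _; rewrite sum1_card.
  rewrite -partition_disjoint_bigcup; last first.
    by move=> i j ij; have /forallP/(_ j)/implyP := dA i; apply.
  by rewrite cA sum1_card cardsT card_ord.
rewrite (bigID (fun i : 'I_n => i < s)%N) /= in card_sum.
have card_uniform : ((n - s) * s.-1 <= \sum_(i < n | ~~ (i < s)) #|A i|)%N.
  have <- : (\sum_(i < n | ~~ (i < s)) s.-1 = (n - s) * s.-1)%N.
    rewrite sum_nat_const; congr (_ * _)%N.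
    have := cardC (fun i : 'I_n => i < s)%N; rewrite card_ord.
    have -> : #|(fun i : 'I_n => i < s)%N| = s.
      by rewrite -sum1_card -(big_ord_widen n (fun=> 1%N)) // sum1_card card_ord.
    by move=> /(canRL (addKn _)) <-; apply: eq_card.
  by apply: leq_sum => i; rewrite -leqNgt => /card_ge; lia.
(* [x] and [y] count the items of block and uniform agents. Here [s * n - (n - s) * (s - 1) = n + s
   * s - s], at most [2 * n] since [s * s <= n]. *)
have arith x y : (x + y = s * n -> (n - s) * s.-1 <= y -> x <= 2 * n /\ y <= s * n)%N.
  have : (s * n <= n + s * s + (n - s) * s.-1)%N.
    by rewrite -(subnK sn) addnK; case: (s) => //= s'; nia.
  by split; lia.
have [big_card uniform_card] := arith _ _ card_sum card_uniform.
rewrite /UW (bigID (fun i : 'I_n => i < s)%N) /=.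
(* Block agents contribute at most [2] (at most [2 * n] items, each worth at most [1/n]), uniform
   agents at most [1]. *)
have -> : 3%:R = 2%:R + 1 :> R by rewrite natr1.
apply: lerD.
  apply: le_trans (_ : \sum_(i < n | (i < s)%N) #|A i|%:R / n%:R <= _).
    by apply: ler_sum => i; apply: val_le.
  rewrite -mulr_suml -natr_sum ler_pdivrMr // -natrM ler_nat.
  exact: big_card.
rewrite (eq_bigr (fun i => #|A i|%:R / (s%:R * n%:R))); last first.
  by move=> i; rewrite -leqNgt => /val_ge.
rewrite -mulr_suml -natr_sum ler_pdivrMr ?mulr_gt0 // mul1r -natrM ler_nat.
exact: uniform_card.
Qed.

End HardInstance.

(** Induction on [n]: [s] grows by one as soon as the next square fits. *)
Lemma exists_sqrt_approx (n : nat) :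
  (0 < n)%N -> exists s, [/\ (0 < s)%N, (s * s <= n)%N & (n <= (s * 2) * (s * 2))%N].
Proof.
elim: n => // -[_ _|n /(_ isT)[s [s0 sn ns]] _]; first by exists 1%N.
have [ssn|ssn] := leqP (s.+1 * s.+1) n.+2.
  by exists s.+1; split=> //; nia.
by exists s; split=> //; nia.
Qed.

(** The constant [6] is [3 * 2]: welfare is at most [3], while the optimum is at least [s], hence at
    least half of the square root of [n]. *)
Lemma PoF_ge (R : realType) (n : nat) :
  (0 < n)%N -> ((6%:R^-1 * Num.sqrt n%:R)%:E <= PoF R n)%E.
Proof.
move=> n0; have [s [s0 ssn ns]] := exists_sqrt_approx n0.
have sn : (s <= n)%N by nia.
have s0R : (0 : R) < s%:R by rewrite ltr0n.
have sqrt_le : Num.sqrt n%:R <= (s * 2)%:R :> R.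
  rewrite -[leRHS]ger0_norm ?ler0n // -sqrtr_sqr ler_sqrt ?exprn_ge0 ?ler0n //.
  by rewrite expr2 -natrM ler_nat.
apply: le_trans (_ : (instance_price (hard_instance R n0 s0) <= _)%E); last first.
  by apply: ereal_sup_ubound; exists (hard_instance R n0 s0).
apply: le_bigmin => [|A /andP[aA pA]]; first exact: leey.
have OPTs := hard_instance_OPT_U R n0 s0 sn.
have UW3 := hard_instance_UW ssn aA pA.
have UW0 : 0 <= UW A by apply: sumr_ge0 => i _; apply: bundle_value_ge0.
(* Zero welfare makes the ratio infinite, because the optimum is at least [s > 0]. *)
rewrite /welfare_ratio; case: eqP => [_|/eqP UWn0].
  by rewrite gt_eqF ?leey // (lt_le_trans s0R).
rewrite lee_fin ler_pdivlMr ?lt_def ?UWn0 //; apply: le_trans OPTs.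
have q0 := sqrtr_ge0 (n%:R : R).
rewrite natrM in sqrt_le; nra.
Qed.

Theorem theorem14 (R : realType) :
  exists c C : R, 0 < c /\ 0 < C /\
    forall n : nat, (3 <= n)%N ->
      ((c * Num.sqrt n%:R)%:E <= PoF R n)%E /\
      (PoF R n <= (C * n%:R)%:E)%E.
Proof.
exists 6%:R^-1, 2%:R; rewrite invr_gt0 !ltr0n; do 2!split=> //.
move=> n n3; have n0 : (0 < n)%N by lia.
split; first exact: PoF_ge.
by apply: ge_ereal_sup => _ [I _ <-]; apply: instance_price_le.
Qed.
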